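(* Let $N(\cdot)$ be a unitarily invariant norm on $M_n(\mathbb{C})$, let $A\in M_n(\mathbb{C})$ be positive definite and let $X\in M_n(\mathbb{C})$. Then the function $h(t)=w_N(A^{t}XA^{t})$ is log-convex on $\mathbb{R}$, i.e. $h((1-\lambda)s+\lambda t)\le h(s)^{1-\lambda}h(t)^{\lambda}$ for all $s,t\in\mathbb{R}$ and $\lambda\in[0,1]$.
   Context: For a norm $N$ on $M_n(\mathbb{C})$ (the $n\times n$ complex matrices), the generalized numerical radius of $Y\in M_n(\mathbb{C})$ is $w_N(Y)=\sup_{\theta\in\mathbb{R}}N(\mathrm{Re}(e^{i\theta}Y))$, where $\mathrm{Re}(Z)=\frac12(Z+Z^* )$. The norm $N$ is unitarily invariant if $N(UYV)=N(Y)$ for all $Y\in M_n(\mathbb{C})$ and all unitary $U,V\in M_n(\mathbb{C})$. For a positive definite (Hermitian) matrix $A$ and $t\in\mathbb{R}$, $A^t$ is defined by the functional calculus. *)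

(* Defs.v *)
From mathcomp Require Import all_boot all_order all_algebra.
From mathcomp.real_closed Require Import complex.
From mathcomp Require Import classical_sets reals exp trigo.

Set Implicit Arguments.
Unset Strict Implicit.
Unset Printing Implicit Defensive.

Import Order.TTheory GRing.Theory Num.Theory.

Local Open Scope ring_scope.
Local Open Scope classical_set_scope.
Local Open Scope complex_scope.
Local Open Scope sesquilinear_scope.

Section Defs.
Context {R : realType} {n : nat}.
Implicit Types (Y Z A : 'M[R[i]]_n) (N : 'M[R[i]]_n -> R).

Definition is_norm N : Prop :=
  [/\ forall Y, 0 <= N Y,
      forall Y, N Y = 0 -> Y = 0,
      forall (c : R[i]) Y, N (c *: Y) = Normc.normc c * N Y
    & forall Y Z, N (Y + Z) <= N Y + N Z].

Definition unitarily_invariant N : Prop :=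
  forall Y U V, U \is unitarymx -> V \is unitarymx -> N (U *m Y *m V) = N Y.

Definition Remx Z : 'M[R[i]]_n := 2^-1 *: (Z + Z^t*).

(* e^{i theta} *)
Definition expi (theta : R) : R[i] := cos theta +i* sin theta.

(* When N is a norm the values are bounded, by (N Y + N (Y^t* )) / 2, so this
   [sup] is a genuine supremum. *)
Definition num_radius N Y : R :=
  sup [set N (Remx (expi theta *: Y)) | theta in [set: R]].

(* On R[i], 0 < z means that z is real and positive. *)
Definition posdefmx A : Prop :=
  A \is hermsymmx /\
  forall x : 'cV[R[i]]_n, x != 0 -> 0 < (x^t* *m A *m x) 0 0.

(* Functional calculus at a real function f, for Hermitian A. A unitary
   diagonalization is chosen; [mxfunE] shows that the choice is irrelevant. *)
Definition mxfun (f : R -> R) A : 'M[R[i]]_n :=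
  (spectralmx A)^t* *m
  diag_mx (map_mx (fun z => (f (complex.Re z))%:C) (spectral_diag A)) *m
  spectralmx A.

Definition powmx A (t : R) : 'M[R[i]]_n := mxfun (fun x => x `^ t) A.

Lemma mxfunE (f : R -> R) A (P : 'M[R[i]]_n) (d : 'rV[R]_n) :
  P \is unitarymx ->
  A = P^t* *m diag_mx (map_mx (fun x => x%:C) d) *m P ->
  mxfun f A = P^t* *m diag_mx (map_mx (fun x => (f x)%:C) d) *m P.
Proof.
move=> Pu AE.
have PP : P *m P^t* = 1%:M by apply/unitarymxP.
have PP' : P^t* *m P = 1%:M by apply: mulmx1C.
have Ah : A \is normalmx.
  apply/normalmxP; rewrite AE !trmx_mul !map_mxM !trmxCK tr_diag_mx map_diag_mx.
  have sandwich (B C : 'M[R[i]]_n) :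
      P^t* *m B *m P *m (P^t* *m C *m P) = P^t* *m (B *m C) *m P.
    by rewrite !mulmxA -[P^t* *m B *m P *m P^t*]mulmxA PP mulmx1.
  by rewrite [P^t* *m (_ *m P)]mulmxA !sandwich diag_mxC.
rewrite /mxfun; have := spectral_unitarymx A.
have /orthomx_spectralP := Ah; set S := spectralmx A; set D := spectral_diag A.
move=> AE2 Su; rewrite invmx_unitary// in AE2.
have SS : S *m S^t* = 1%:M by apply/unitarymxP.
have SS' : S^t* *m S = 1%:M by apply: mulmx1C.
pose Q := S *m P^t*.
have QE : diag_mx D *m Q = Q *m diag_mx (map_mx (fun x => x%:C) d).
  have : S *m A *m P^t* = S *m A *m P^t* by [].
  rewrite {1}AE2 AE !mulmxA SS mul1mx /Q => ->.
  by rewrite -!mulmxA PP mulmx1.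
have fE : diag_mx (map_mx (fun z => (f (complex.Re z))%:C) D) *m Q =
          Q *m diag_mx (map_mx (fun x => (f x)%:C) d).
  apply/matrixP => i j; move/matrixP/(_ i j): QE; move: Q => Q.
  rewrite !mul_diag_mx !mul_mx_diag !mxE ![_ * Q i j]mulrC.
  have [->|Q0] := eqVneq (Q i j) 0; first by rewrite !mul0r.
  by move=> /(mulfI Q0) ->.
transitivity (S^t* *m (diag_mx (map_mx (fun z => (f (complex.Re z))%:C) D) *m Q) *m P).
  by rewrite /Q -!mulmxA PP' mulmx1.
by rewrite fE /Q !mulmxA SS' mul1mx.
Qed.

End Defs.

Definition log_convex {R : realType} (h : R -> R) : Prop :=
  forall s t lam : R, 0 <= lam <= 1 ->
    h ((1 - lam) * s + lam * t) <= h s `^ (1 - lam) * h t `^ lam.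

(* Main.v *)
(** In an eigenbasis of [A] the map [X |-> A^t X A^t] multiplies the [(i, j)]
    entry by [e^(t x)] with [x = ln d_i + ln d_j]. With [x] replaced by [i x]
    this entrywise multiplication is left and right multiplication by a diagonal
    unitary, hence isometric for [N]. As
    [e^(hx) + e^(-hx) + e^(ihx) + e^(-ihx) = 4 + o(h^2)], the triangle inequality
    bounds the second difference of [g t = N (A^t X A^t)] below by [- o(h^2)], so
    [g] is convex by the maximum principle. Rescaling [A] improves convexity to
    log-convexity, and [Re (e^(i theta) A^t X A^t) = A^t (Re (e^(i theta) X)) A^t],
    so that [w_N (A^t X A^t)] is a supremum of log-convex functions. *)
Require Import Defs.
From mathcomp Require Import all_boot all_order all_algebra.
From mathcomp.real_closed Require Import complex.
From mathcomp Require Import classical_sets reals topology normedtype derive.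
From mathcomp Require Import sequences realfun exp trigo.
From mathcomp Require Import ring lra.

Set Implicit Arguments.
Unset Strict Implicit.
Unset Printing Implicit Defensive.

Import Order.TTheory GRing.Theory Num.Theory.
Import numFieldNormedType.Exports.

Local Open Scope ring_scope.
Local Open Scope classical_set_scope.
Local Open Scope complex_scope.
Local Open Scope sesquilinear_scope.

(** * Real analysis: a Taylor remainder and convexity from second differences *)

Section RealLemmas.
Context {R : realType}.
Implicit Types (f g : R -> R) (e x y h : R).

Lemma le_norm_MVT0 f (df : R -> R) (C y : R) :
  (forall x, is_derive x 1 f (df x)) -> f 0 = 0 ->
  (forall x, `|x| <= `|y| -> `|df x| <= C) -> `|f y| <= C * `|y|.
Proof.
move=> fdf f0 dfC.
have cf a b : {within `[a, b], continuous f}.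
  by apply: derivable_within_continuous => x _; case: (fdf x).
have [y0|y0] := leP 0 y.
  have [c] := MVT_segment y0 (fun x _ => fdf x) (cf _ _).
  rewrite in_itv/= f0 !subr0 => /andP[c0 cy] ->; rewrite normrM.
  by apply: ler_wpM2r => //; apply: dfC; rewrite !ger0_norm.
have [c] := MVT_segment (ltW y0) (fun x _ => fdf x) (cf _ _).
rewrite in_itv/= f0 !sub0r => /andP[yc c0]; rewrite mulrN => /oppr_inj ->.
rewrite normrM; apply: ler_wpM2r => //; apply: dfC.
by rewrite !ler0_norm ?lerN2// ltW.
Qed.

(** The function and its first two derivatives vanish at 0. The second derivative [f2] is
    continuous, hence at most [e] in absolute value near 0, and two mean value estimates turn this
    into [e * y ^+ 2]. *)
Lemma cosh_cos_small e : 0 < e -> exists2 d : R, 0 < d &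
  forall y, `|y| < d -> `|expR y + expR (- y) + 2 * cos y - 4| <= e * y ^+ 2.
Proof.
move=> e0.
pose f2 := fun x : R => expR x + expR (- x) - 2 * cos x.
have f2c : continuous f2.
  move=> x; apply: cvgB.
    apply: cvgD; first exact: continuous_expR.
    apply: continuous_comp; [exact: opp_continuous | exact: continuous_expR].
  by apply: cvgM; [exact: cvg_cst | exact: continuous_cos].
have f20 : f2 0 = 0 by rewrite /f2 oppr0 expR0 cos0; ring.
have /cvgrPdist_lt/(_ _ e0) := f2c 0; rewrite f20.
move=> /nbhs_ballP[d /= d0 dP]; exists d => // y yd.
have -> : y ^+ 2 = `|y| * `|y| by rewrite -expr2 -normrX ger0_norm ?sqr_ge0.
rewrite mulrA.
apply: (@le_norm_MVT0 (fun y => expR y + expR (- y) + 2 * cos y - 4)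
  (fun y => expR y - expR (- y) - 2 * sin y)).
- move=> x; apply: is_derive_eq; rewrite ?scaler0 /GRing.scale/=; ring.
- by rewrite oppr0 expR0 cos0; ring.
move=> x xy; apply: (@le_trans _ _ (e * `|x|)); last by rewrite ler_wpM2l// ltW.
apply: (@le_norm_MVT0 (fun y => expR y - expR (- y) - 2 * sin y) f2).
- move=> z; rewrite /f2; apply: is_derive_eq; rewrite ?scaler0 /GRing.scale/=; ring.
- by rewrite oppr0 expR0 sin0; ring.
move=> z zx; have := dP z; rewrite /ball/= !sub0r !normrN => H; apply/ltW/H.
exact: le_lt_trans (le_trans zx xy) yd.
Qed.

(* Maximum principle: after adding a small multiple of [t (t - 1)] the second
   differences become positive, which excludes an interior maximum. *)
Lemma convex_max_principle g : continuous g ->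
  (forall t e, 0 < e -> exists2 d : R, 0 < d & forall h, `|h| < d ->
    2 * g t - e * h ^+ 2 <= g (t + h) + g (t - h)) ->
  forall t, 0 <= t <= 1 -> g t <= (1 - t) * g 0 + t * g 1.
Proof.
move=> gc gd t /andP[t0 t1]; rewrite leNgt; apply/negP => gt.
pose eta := g t - ((1 - t) * g 0 + t * g 1).
have eta0 : 0 < eta by rewrite /eta subr_gt0.
(* [psi] vanishes at 0 and 1 and is positive at [t], so its maximum is interior. The quadratic term
   adds [2 * eta * h ^+ 2] to the second difference, against a loss of at most [eta * h ^+ 2] from
   [g]. *)
pose psi x := g x - ((1 - x) * g 0 + x * g 1) - eta * (x * (1 - x)).
have psic : continuous psi.
  have c1B (x : R) : 1 - y @[y --> x] --> 1 - x.
    by apply: cvgB; [exact: cvg_cst | exact: cvg_id].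
  move=> x; apply: cvgB; first apply: cvgB; first exact: gc.
    by apply: cvgD; apply: cvgM;
      first [exact: c1B | exact: cvg_cst | exact: cvg_id].
  by apply: cvgM; [exact: cvg_cst | apply: cvgM; [exact: cvg_id | exact: c1B]].
have [c] := EVT_max ler01 (continuous_subspaceT psic).
rewrite in_itv/= => /andP[c0 c1] cmax.
have psi_c : 0 < psi c.
  apply: lt_le_trans (cmax t _); last by rewrite in_itv/= t0.
  have q1 : 0 < 1 - t * (1 - t) by nra.
  by rewrite /psi -/eta -[X in X - _]mulr1 -mulrBr mulr_gt0.
have {}c0 : 0 < c.
  rewrite lt_neqAle c0 andbT; apply/eqP => c0'; move: psi_c.
  by rewrite -c0' /psi; lra.
have {}c1 : c < 1.
  rewrite lt_neqAle c1 andbT; apply/eqP => c1'; move: psi_c.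
  by rewrite c1' /psi; lra.
have [d d0 dP] := gd c eta eta0.
(* Small enough for the bound at [c] and for [c - h], [c + h] to stay in [0, 1]. *)
pose h := Num.min (d / 2) (Num.min c (1 - c)).
have h0 : 0 < h by rewrite !lt_min; apply/and3P; split; lra.
have hd : h < d by rewrite /h !gt_min; apply/orP; left; lra.
have hc : h <= c by rewrite /h !ge_min lexx !orbT.
have h1c : h <= 1 - c by rewrite /h !ge_min lexx !orbT.
have := dP h; rewrite gtr0_norm// => /(_ hd).
have : psi (c + h) <= psi c.
  by apply: cmax; rewrite in_itv/=; apply/andP; split; lra.
have : psi (c - h) <= psi c.
  by apply: cmax; rewrite in_itv/=; apply/andP; split; lra.
have : 0 < eta * h ^+ 2 by rewrite mulr_gt0// exprn_gt0.
rewrite /psi; nra.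
Qed.
End RealLemmas.

Lemma normcR {R : realType} (x : R) : Normc.normc x%:C = `|x|.
Proof. by rewrite /Normc.normc/= expr0n addr0 sqrtr_sqr. Qed.

Lemma normc_expi {R : realType} (x : R) : Normc.normc (expi x) = 1.
Proof. by rewrite /Normc.normc/= cos2Dsin2 sqrtr1. Qed.

Lemma expiD {R : realType} (x y : R) : expi (x + y) = expi x * expi y.
Proof.
rewrite /expi cosD sinD; apply/eqP; rewrite eq_complex/= eqxx/=.
by apply/eqP; ring.
Qed.

Lemma expi_unitary {R : realType} (x : R) : expi x * (expi x)^* = 1.
Proof.
apply/eqP; rewrite eq_complex/=; apply/andP; split; apply/eqP; last by ring.
by rewrite -(cos2Dsin2 x); ring.
Qed.

(** * Entrywise multipliers and their effect on norms *)

Section Hadamard.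
Context {R : realType} {n : nat}.
Implicit Types (F G : 'I_n -> 'I_n -> R[i]) (Y Z : 'M[R[i]]_n).

Definition hadamard F Y : 'M[R[i]]_n := \matrix_(i, j) (F i j * Y i j).

(** The weights of [X |-> A^t X A^t] when [A] is diagonal with entries [e^(a i)]. *)
Definition expw (a : 'I_n -> R) (t : R) (i j : 'I_n) : R[i] :=
  (expR (t * (a i + a j)))%:C.

Lemma hadamardA F G Y :
  hadamard F (hadamard G Y) = hadamard (fun i j => F i j * G i j) Y.
Proof. by apply/matrixP => i j; rewrite !mxE mulrA. Qed.

Lemma hadamardDl F G Y :
  hadamard (fun i j => F i j + G i j) Y = hadamard F Y + hadamard G Y.
Proof. by apply/matrixP => i j; rewrite !mxE mulrDl. Qed.

Lemma hadamardBl F G Y :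
  hadamard (fun i j => F i j - G i j) Y = hadamard F Y - hadamard G Y.
Proof. by apply/matrixP => i j; rewrite !mxE mulrBl. Qed.

Lemma eq_hadamard F G Y : (forall i j, F i j = G i j) ->
  hadamard F Y = hadamard G Y.
Proof. by move=> FG; apply/matrixP => i j; rewrite !mxE FG. Qed.

Lemma hadamard_cst (c : R[i]) Y : hadamard (fun _ _ => c) Y = c *: Y.
Proof. by apply/matrixP => i j; rewrite !mxE. Qed.

Lemma hadamard_expwD a (s t : R) Y :
  hadamard (expw a (s + t)) Y = hadamard (expw a t) (hadamard (expw a s) Y).
Proof.
rewrite hadamardA; apply: eq_hadamard => i j.
by rewrite /expw -rmorphM/= -expRD -mulrDl addrC.
Qed.

Lemma diag_hadamard (d e : 'rV[R[i]]_n) Y :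
  diag_mx d *m Y *m diag_mx e = hadamard (fun i j => d 0 i * e 0 j) Y.
Proof.
apply/matrixP => i j; rewrite mul_mx_diag mul_diag_mx !mxE.
by rewrite mulrAC.
Qed.

Lemma diag_expi_unitary (a : 'I_n -> R) :
  diag_mx (\row_i expi (a i)) \is unitarymx.
Proof.
apply/unitarymxP; rewrite tr_diag_mx map_diag_mx mulmx_diag.
apply/matrixP => i j; rewrite !mxE.
by rewrite expi_unitary.
Qed.

Section UINorm.
Context (N : 'M[R[i]]_n -> R) (normN : is_norm N).

Lemma is_norm0 : N 0 = 0.
Proof. by case: normN => _ _ NZ _; rewrite -(scale0r 0) NZ Normc.normc0 mul0r. Qed.

Lemma is_normN Y : N (- Y) = N Y.
Proof.
case: normN => _ _ NZ _; rewrite -scaleN1r NZ.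
have -> : (-1 : R[i]) = (-1)%:C by rewrite rmorphN rmorph1.
by rewrite normcR normrN1 mul1r.
Qed.

(** Triangle inequality over the expansion in matrix units. This crude bound suffices to show that
    small weights give a small norm. *)
Lemma is_norm_hadamard_le (f : 'I_n -> 'I_n -> R) Y :
  N (hadamard (fun i j => (f i j)%:C) Y) <=
  \sum_i \sum_j `|f i j| * N (Y i j *: delta_mx i j).
Proof.
have [_ _ NZ ND] := normN.
have Nsum (T : finType) (G : T -> 'M[R[i]]_n) : N (\sum_i G i) <= \sum_i N (G i).
  elim/big_ind2 : _ => [||//]; first by rewrite is_norm0.
  by move=> y a z b ya zb; apply: le_trans (ND _ _) _; exact: lerD.
rewrite [X in N X]matrix_sum_delta; apply: le_trans (Nsum _ _) _.
apply: ler_sum => i _; apply: le_trans (Nsum _ _) _; apply: ler_sum => j _.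
by rewrite mxE -scalerA NZ normcR.
Qed.

Lemma hadamard_expw_continuous a Y :
  continuous (fun t : R => N (hadamard (expw a t) Y)).
Proof.
have [_ _ _ ND] := normN.
(* [b] dominates the difference of the two norms in either order, by symmetry, and tends to 0 as [s]
   tends to [t]. *)
pose b (t s : R) := \sum_i \sum_j
  `|expR (t * (a i + a j)) - expR (s * (a i + a j))| * N (Y i j *: delta_mx i j).
have le_b t s : N (hadamard (expw a t) Y) - N (hadamard (expw a s) Y) <= b t s.
  apply: le_trans (is_norm_hadamard_le _ _); rewrite lerBlDr.
  have -> : hadamard (expw a t) Y = hadamard (fun i j =>
      (expR (t * (a i + a j)) - expR (s * (a i + a j)))%:C) Y + hadamard (expw a s) Y.
    by rewrite -hadamardDl; apply: eq_hadamard => i j; rewrite rmorphB/= subrK.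
  exact: ND.
have b_sym t s : b t s = b s t.
  by apply: eq_bigr => i _; apply: eq_bigr => j _; rewrite distrC.
move=> t.
have bc : b t s @[s --> t] --> 0.
  rewrite [X in _ --> X](_ : _ = b t t); last first.
    rewrite /b big1// => i _; rewrite big1// => j _.
    by rewrite subrr normr0 mul0r.
  do 2!(apply: cvg_big => [|? _]; first exact: add_continuous).
  apply: cvgM; last exact: cvg_cst.
  apply: cvg_norm; apply: cvgB; first exact: cvg_cst.
  apply: continuous_comp; last exact: continuous_expR.
  by apply: cvgM; [exact: cvg_id | exact: cvg_cst].
apply/cvgrPdist_lt => e e0; move/cvgrPdist_lt : bc => /(_ _ e0).
apply: filterS => s; rewrite sub0r normrN; apply: le_lt_trans.
apply: (@le_trans _ _ (b t s)); last exact: ler_norm.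
by rewrite ler_norml lerNl opprB {1}b_sym !le_b.
Qed.

Hypothesis uiN : unitarily_invariant N.

(** The weights factor as [e^(i t a_i) e^(i t a_j)], so the product is [D *m Y *m D] with [D] a
    diagonal unitary. *)
Lemma hadamard_expi_norm a (t : R) Y :
  N (hadamard (fun i j => expi (t * (a i + a j))) Y) = N Y.
Proof.
pose D := diag_mx (\row_i expi (t * a i)).
rewrite -(@uiN Y D D) ?diag_expi_unitary// /D diag_hadamard.
by congr N; apply: eq_hadamard => i j; rewrite !mxE -expiD mulrDr.
Qed.

(* [e^x + e^-x + e^(ix) + e^(-ix) = 4 + o(x^2)], and the last two terms act
   isometrically. *)
Lemma hadamard_expw_second_difference a Y (e : R) : 0 < e ->
  exists2 d : R, 0 < d & forall h, `|h| < d -> 2 * N Y - e * h ^+ 2 <=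
    N (hadamard (expw a h) Y) + N (hadamard (expw a (- h)) Y).
Proof.
move=> e0; have [N0 _ NZ ND] := normN.
pose K := \sum_i \sum_j N (Y i j *: delta_mx i j).
have K0 : 0 <= K by do 2!apply: sumr_ge0 => ? _.
pose M := 1 + \sum_i \sum_j `|a i + a j|.
have M0 : 0 < M by rewrite ltr_pwDl//; do 2!apply: sumr_ge0 => ? _.
have xM i j : `|a i + a j| <= M.
  rewrite /M (bigD1 i)//= (bigD1 j)//=.
  set u := `|a i + a j|; set v := \sum_(_ | _) _; set w := \sum_(_ | _) _.
  have v0 : 0 <= v by apply: sumr_ge0.
  have w0 : 0 <= w by do 2!apply: sumr_ge0 => ? _.
  lra.
(* Chosen so that [e' * M ^+ 2 * K <= e]; the summands 1 in [M] and in [K + 1] keep the denominator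
   positive. *)
pose e' := e / (M ^+ 2 * (K + 1)).
have e'0 : 0 < e' by rewrite divr_gt0// mulr_gt0 ?exprn_gt0// ltr_wpDl.
have [d d0 dP] := cosh_cos_small e'0.
exists (d / M); first exact: divr_gt0.
move=> h hd.
pose r (x : R) : R := expR x + expR (- x) + 2 * cos x - 4.
pose x i j := h * (a i + a j).
have xhM i j : `|x i j| <= `|h| * M by rewrite normrM ler_wpM2l.
have re i j : `|r (x i j)| <= e' * M ^+ 2 * h ^+ 2.
  apply: le_trans (dP _ _) _.
    by apply: le_lt_trans (xhM i j) _; rewrite -ltr_pdivlMr.
  rewrite -mulrA ler_pM2l// -[x i j ^+ 2]ger0_norm ?sqr_ge0// normrX.
  rewrite -[h ^+ 2]ger0_norm ?sqr_ge0// normrX -exprMn mulrC.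
  by rewrite lerXn2r ?nnegrE// ?(mulr_ge0)// ltW.
have Nr : N (hadamard (fun i j => (r (x i j))%:C) Y) <= e * h ^+ 2.
  apply: le_trans (is_norm_hadamard_le _ _) _.
  apply: (@le_trans _ _ (e' * M ^+ 2 * h ^+ 2 * K)).
    rewrite /K mulr_sumr; apply: ler_sum => i _; rewrite mulr_sumr.
    by apply: ler_sum => j _; rewrite ler_wpM2r.
  rewrite mulrAC ler_wpM2r ?sqr_ge0//.
  have -> : e' * M ^+ 2 * K = e * (K / (K + 1)).
    by rewrite /e'; field; rewrite !gt_eqF// ltr_wpDl.
  by rewrite ger_pMr// ler_pdivrMr ?ltr_wpDl// mul1r lerDl.
(* Exact identity with remainder [r]. The two oscillating terms have norm [N Y] each, so the
   triangle inequality leaves [2 * N Y] on the left. *)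
have E : 4%:R *: Y = hadamard (expw a h) Y + hadamard (expw a (- h)) Y +
    (hadamard (fun i j => expi (h * (a i + a j))) Y +
     hadamard (fun i j => expi ((- h) * (a i + a j))) Y) -
    hadamard (fun i j => (r (x i j))%:C) Y.
  rewrite -!hadamardDl -hadamardBl -hadamard_cst; apply: eq_hadamard => i j.
  rewrite /expw /expi /r !mulNr cosN sinN -/(x i j).
  apply/eqP; rewrite eq_complex/=; apply/andP; split; apply/eqP; ring.
have N4 : N (4%:R *: Y) = 4 * N Y.
  by rewrite NZ -(rmorph_nat (real_complex R)) normcR ger0_norm.
have := ND (hadamard (expw a h) Y + hadamard (expw a (- h)) Y +
    (hadamard (fun i j => expi (h * (a i + a j))) Y +
     hadamard (fun i j => expi ((- h) * (a i + a j))) Y)) (-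
    hadamard (fun i j => (r (x i j))%:C) Y).
rewrite -E N4 is_normN.
have := ND (hadamard (expw a h) Y + hadamard (expw a (- h)) Y)
    (hadamard (fun i j => expi (h * (a i + a j))) Y +
     hadamard (fun i j => expi ((- h) * (a i + a j))) Y).
have := ND (hadamard (expw a h) Y) (hadamard (expw a (- h)) Y).
have := ND (hadamard (fun i j => expi (h * (a i + a j))) Y)
     (hadamard (fun i j => expi ((- h) * (a i + a j))) Y).
rewrite !hadamard_expi_norm; lra.
Qed.

(** By the group law of the weights, the second difference at [s] is the one at 0 for the matrix
    [hadamard (expw a s) Y]. *)
Lemma hadamard_expw_convex a Y (t : R) : 0 <= t <= 1 ->
  N (hadamard (expw a t) Y) <= (1 - t) * N Y + t * N (hadamard (expw a 1) Y).
Proof.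
move=> t01.
have Y0 : hadamard (expw a 0) Y = Y.
  by apply/matrixP => i j; rewrite !mxE /expw mul0r expR0 mul1r.
rewrite -{2}Y0.
apply: (convex_max_principle (g := fun t => N (hadamard (expw a t) Y))) => //.
  exact: hadamard_expw_continuous.
move=> s e e0.
have [d d0 dP] := hadamard_expw_second_difference a (hadamard (expw a s) Y) e0.
by exists d => // h /dP; rewrite -!hadamard_expwD.
Qed.

(* Translating [a] by a constant [k] multiplies the weights by [e^(2kt)]; the
   value of [k] equalizes the two end values in [hadamard_expw_convex]. *)
Lemma hadamard_expw_log_convex01 a Y (t : R) : 0 <= t <= 1 ->
  N (hadamard (expw a t) Y) <=
  N Y `^ (1 - t) * N (hadamard (expw a 1) Y) `^ t.
Proof.
move=> t01; have [N0 N0eq NZ _] := normN.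
have [Y0|Y0] := eqVneq Y 0.
  rewrite Y0 (_ : hadamard (expw a t) 0 = 0) ?is_norm0 ?mulr_ge0 ?powR_ge0//.
  by apply/matrixP => i j; rewrite !mxE mulr0.
have p0 : 0 < N Y.
  by rewrite lt_neqAle N0 andbT eq_sym; apply: contra_neq Y0 => /N0eq.
have q0 : 0 < N (hadamard (expw a 1) Y).
  rewrite lt_neqAle N0 andbT eq_sym; apply: contra_neq Y0 => /N0eq Z0.
  apply/matrixP => i j; move/matrixP/(_ i j) : Z0; rewrite !mxE => /eqP.
  rewrite mulf_eq0 => /orP[|/eqP//].
  by rewrite /expw eq_complex/= eqxx andbT gt_eqF ?expR_gt0.
set p := N Y in p0 *; set q := N _ in q0 *.
pose c := ln p - ln q.
pose b i := a i + c / 2.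
have expwE (s : R) : hadamard (expw b s) Y = (expR (s * c))%:C *: hadamard (expw a s) Y.
  apply/matrixP => i j; rewrite !mxE /expw mulrA -rmorphM/= -expRD.
  by congr ((expR _)%:C * _); rewrite /b; field.
have := hadamard_expw_convex b Y t01.
rewrite (expwE t) (expwE 1) !NZ !normcR !ger0_norm ?expR_ge0// mul1r -/p -/q.
have -> : expR c * q = p.
  by rewrite -{1}(lnK (x := q)) ?posrE// -expRD subrK lnK ?posrE.
(* Both end values are now [p], so convexity bounds the norm by [p / e^(t c)], which equals
   [p^(1 - t) q^t]. *)
rewrite -mulrDl subrK mul1r mulrC -ler_pdivlMr ?expR_gt0// => /le_trans; apply.
rewrite /powR !gt_eqF// -expRN -{1}(lnK (x := p)) ?posrE// -!expRD ler_expR.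
by rewrite le_eqVlt; apply/orP; left; apply/eqP; rewrite /c; ring.
Qed.

(** Reduction to [0, 1]: moving from [s] to [t] amounts to starting at [hadamard (expw a s) Y] with
    exponents [(t - s) * a i], whatever the sign of [t - s]. *)
Lemma hadamard_expw_log_convex a Y :
  log_convex (fun t => N (hadamard (expw a t) Y)).
Proof.
move=> s t l l01.
have E (u : R) : hadamard (expw a (s + u * (t - s))) Y =
    hadamard (expw (fun i => (t - s) * a i) u) (hadamard (expw a s) Y).
  rewrite hadamard_expwD; apply: eq_hadamard => i j; rewrite /expw.
  by rewrite -mulrDr mulrA.
have -> : (1 - l) * s + l * t = s + l * (t - s) by ring.
rewrite /= (E l).
have -> : hadamard (expw a t) Y = hadamard (expw a (s + 1 * (t - s))) Y.
  by rewrite mul1r addrC subrK.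
by rewrite (E 1); apply: hadamard_expw_log_convex01.
Qed.

End UINorm.
End Hadamard.

(** * The numerical radius and the passage to an eigenbasis of [A] *)

Section NumRadius.
Context {R : realType} {n : nat}.
Implicit Types (A X Y Z : 'M[R[i]]_n) (N : 'M[R[i]]_n -> R).

Lemma trmxC_mul3 (A B C : 'M[R[i]]_n) : (A *m B *m C)^t* = C^t* *m B^t* *m A^t*.
Proof. by rewrite !trmx_mul !map_mxM mulmxA. Qed.

Lemma Remx_congr (B : 'M[R[i]]_n) (c : R[i]) Z :
  Remx (c *: (B^t* *m Z *m B)) = B^t* *m Remx (c *: Z) *m B.
Proof.
rewrite /Remx -scalemxAr -scalemxAl mulmxDr mulmxDl; congr (_ *: (_ + _)).
  by rewrite -scalemxAr -scalemxAl.
by rewrite scalemxAl scalemxAr trmxC_mul3 trmxCK.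
Qed.

(** Phases have modulus 1, so the bound does not depend on [theta]. Boundedness is what lets [sup]
    dominate each value. *)
Lemma num_radius_ub N Y : is_norm N ->
  has_ubound [set N (Remx (expi theta *: Y)) | theta in [set: R]].
Proof.
case=> _ _ NZ ND; exists (Normc.normc (2^-1 : R[i]) * (N Y + N (Y^t*))).
move=> _ [theta _ <-]; rewrite /Remx NZ; apply: ler_wpM2l.
  by rewrite /Normc.normc; case: (_^-1) => u v; exact: sqrtr_ge0.
apply: le_trans (ND _ _) _; rewrite linearZ/= map_mxZ !NZ normc_expi mul1r.
rewrite (_ : Normc.normc _ = 1) ?mul1r//.
by rewrite /Normc.normc/= sqrrN cos2Dsin2 sqrtr1.
Qed.

Lemma num_radius_ge N Y (theta : R) : is_norm N ->
  N (Remx (expi theta *: Y)) <= num_radius N Y.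
Proof.
move=> Nn; apply: (ub_le_sup (num_radius_ub Y Nn)).
by exists theta.
Qed.

(** The quadratic form at the [i]-th column of [P^t*], a unit eigenvector, is the [i]-th
    eigenvalue. *)
Lemma posdefmx_spectral_gt0 A i : posdefmx A -> 0 < spectral_diag A 0 i.
Proof.
move=> [Ah Apos]; have Pu := spectral_unitarymx A.
have /orthomx_spectralP := hermitian_normalmx Ah.
rewrite invmx_unitary//; set P := spectralmx A in Pu *.
set d := spectral_diag A => AE.
have PP : P *m P^t* = 1%:M by apply/unitarymxP.
have := Apos (P^t* *m delta_mx i 0); rewrite {1}AE.
have -> : (P^t* *m delta_mx i 0)^t* = delta_mx 0 i *m P :> 'rV[R[i]]_n.
  by rewrite trmx_mul map_mxM trmxCK trmx_delta map_delta_mx.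
rewrite !mulmxA -[_ *m P *m P^t*]mulmxA PP mulmx1.
rewrite -[_ *m P *m P^t*]mulmxA PP mulmx1.
rewrite -rowE -[row i _ *m _]colE !mxE eqxx mulr1n; apply.
apply/eqP => /(congr1 (mulmx P)); rewrite mulmxA PP mul1mx mulmx0.
by move/matrixP/(_ i 0)/eqP; rewrite !mxE !eqxx oner_eq0.
Qed.

(** [Remx] commutes with the congruences by [P] and by the real diagonal [D]; unitary invariance
    removes the first, and the second is an entrywise product. *)
Lemma Remx_powmx_hadamard N A X (t theta : R) :
  unitarily_invariant N -> posdefmx A ->
  N (Remx (expi theta *: (powmx A t *m X *m powmx A t))) =
  N (hadamard (expw (fun i => ln (complex.Re (spectral_diag A 0 i))) t)
     (Remx (expi theta *: (spectralmx A *m X *m (spectralmx A)^t*)))).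
Proof.
move=> Nu Ap; have Pu := spectral_unitarymx A.
rewrite /powmx /mxfun; set P := spectralmx A in Pu *.
set D := diag_mx _.
have Dh : D^t* = D.
  rewrite /D tr_diag_mx map_diag_mx; congr diag_mx; apply/rowP => i.
  by rewrite !mxE; apply/eqP; rewrite eq_complex/= oppr0 !eqxx.
have -> : P^t* *m D *m P *m X *m (P^t* *m D *m P) =
    P^t* *m (D^t* *m (P *m X *m P^t*) *m D) *m P by rewrite Dh !mulmxA.
rewrite !Remx_congr Nu ?trmxC_unitary// Dh /D diag_hadamard; congr N.
apply: eq_hadamard => i j; rewrite !mxE /expw -rmorphM/=.
(* [powR] is defined separately at base 0; elsewhere [x ^ t] unfolds to [e^(t ln x)]. *)
have d0 k : (complex.Re (spectral_diag A 0 k) == 0) = false.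
  apply: gt_eqF; have := posdefmx_spectral_gt0 k Ap.
  by case: (spectral_diag A 0 k) => u v; rewrite ltcE/= => /andP[].
by rewrite /powR !d0 -expRD mulrDr.
Qed.

End NumRadius.

Theorem mainTheorem4 (R : realType) (n : nat) (N : 'M[R[i]]_n -> R)
    (A X : 'M[R[i]]_n) :
  is_norm N -> unitarily_invariant N -> posdefmx A ->
  log_convex (fun t : R => num_radius N (powmx A t *m X *m powmx A t)).
Proof.
move=> Nn Nu Ap s t l l01.
apply: ge_sup => [|_ [theta _ <-]].
  by exists (N (Remx (expi 0 *: (powmx A ((1 - l) * s + l * t) *m X *m
    powmx A ((1 - l) * s + l * t))))), 0.
(* For fixed [theta] the exponents do not involve [theta], so log-convexity applies to this term;
   each factor is then at most the corresponding power of the supremum. *)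
rewrite Remx_powmx_hadamard//.
apply: le_trans (hadamard_expw_log_convex Nn Nu _ _ s t l01) _.
rewrite -!Remx_powmx_hadamard//.
have N0 Y : 0 <= N Y by case: Nn.
have [l0 l1] := andP l01.
have l10 : 0 <= 1 - l by rewrite subr_ge0.
have w0 Y : 0 <= num_radius N Y := le_trans (N0 _) (num_radius_ge Y 0 Nn).
by apply: ler_pM; rewrite ?powR_ge0// ge0_ler_powR ?nnegrE ?num_radius_ge.
Qed.
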